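(* Let $X$ be a locally compact Hausdorff space, and let $T$ be a closed semiregular operator on $C_0(X)$. Then $T$ is regular.
   Context: $C_0(X)$ is the $C^*$-algebra of continuous complex functions on $X$ vanishing at infinity, viewed as a Hilbert module over itself with $\langle a,b\rangle=a^*b$. For a $C^*$-algebra $\mathcal{A}$, an operator $T$ on $\mathcal{A}$ is a linear map from a linear subspace $D(T)\subseteq\mathcal{A}$ to $\mathcal{A}$; its adjoint (for $D(T)$ dense) has domain $D(T^* )=\{y\in\mathcal{A}:\exists z\in\mathcal{A},\ \langle Tx,y\rangle=\langle x,z\rangle\ \forall x\in D(T)\}$ and $T^*y=z$. $T$ is semiregular if (a) $D(T)$ is a dense right submodule (right ideal) of $\mathcal{A}$, (b) $T$ is closable, (c) $T^*$ is densely defined. $T$ is regular if it is a closed semiregular operator such that the range of $I+T^*T$ is dense in $\mathcal{A}$, where $D(T^*T)=\{x\in D(T):Tx\in D(T^* )\}$. *)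

(* Defs.v *)
From HB Require Import structures.
From mathcomp Require Import all_boot all_order all_algebra.
From mathcomp Require Import complex.
From mathcomp Require Import all_classical all_reals all_analysis.

Set Implicit Arguments.
Unset Strict Implicit.
Unset Printing Implicit Defensive.

Import Order.TTheory GRing.Theory Num.Theory numFieldNormedType.Exports.
Import Normc.

Local Open Scope classical_set_scope.
Local Open Scope ring_scope.
Local Open Scope complex_scope.

HB.instance Definition _ (R : realType) := NormedModule.copy R[i] R[i]^o.

Section ComplexTopology.
Variable R : realType.

Lemma normcDle (x y : R[i]) : normc (x + y) <= normc x + normc y.
Proof. exact: (@le_normcD R x y). Qed.

Lemma normc_ge0 (x : R[i]) : 0 <= normc x.
Proof. by case: x => a b; exact: sqrtr_ge0. Qed.

Lemma normc_real (a : R) : normc a%:C = `|a|.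
Proof. by rewrite /normc /= expr0n /= addr0 sqrtr_sqr. Qed.

Lemma normc_conj (x : R[i]) : normc x^* = normc x.
Proof. by case: x => a b; rewrite /normc /= sqrrN. Qed.

Lemma cvg_normcP (T : topologicalType) (f : T -> R[i]) (x : T) :
  f @ x --> f x <->
  (forall e : R, 0 < e -> \forall y \near x, normc (f x - f y) < e).
Proof.
split=> [/cvgrPdist_lt fx e e0|fx].
  have e0' : 0 < e%:C by rewrite ltcR.
  by have := fx _ e0'; apply: filterS => y; rewrite -[`|_|]/((normc _)%:C) ltcR.
apply/cvgrPdist_lt => -[a b] e0.
move: e0; rewrite ltcE /= => /andP[/eqP -> a0].
by apply: filterS (fx _ a0) => y; rewrite -[`|_|]/((normc _)%:C) ltcR.
Qed.

Lemma normc_dist (x y : R[i]) : `|normc x - normc y| <= normc (x - y).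
Proof.
rewrite ler_norml; apply/andP; split.
  rewrite lerBrDr addrC lerBlDr.
  rewrite -[normc (x - y)]normcN opprB addrC.
  by rewrite -{1}(subrK x y); exact: normcDle.
by rewrite lerBlDr -{1}(subrK y x); exact: normcDle.
Qed.

Lemma continuous_normc : continuous (@normc R : R[i] -> R).
Proof.
move=> x; apply/(@cvgrPdist_lt _ _ _ (nbhs x)) => e e0.
have /cvg_normcP/(_ e e0) : id @ x --> x by exact: cvg_id.
by apply: filterS => y; apply: le_lt_trans; exact: normc_dist.
Qed.

Lemma continuous_conjc : continuous (@conjc R : R[i] -> R[i]).
Proof.
move=> x; apply/cvg_normcP => e e0.
have /cvg_normcP/(_ e e0) : id @ x --> x by exact: cvg_id.
by apply: filterS => y; rewrite -raddfB normc_conj.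
Qed.

End ComplexTopology.

Definition vanishes_at_infinity (R : realType) (X : topologicalType)
    (f : X -> R[i]) : Prop :=
  forall e : R, 0 < e -> compact [set x | e <= normc (f x)].

Definition C0_pred (R : realType) (X : topologicalType) : {pred X -> R[i]} :=
  [pred f | `[< continuous f /\ vanishes_at_infinity f >]].

Arguments C0_pred : clear implicits.

Record C0 (R : realType) (X : topologicalType) := MkC0 {
  C0_fun :> X -> R[i];
  C0P : C0_fun \in C0_pred R X
}.

Section C0_lmodType.
Variables (R : realType) (X : topologicalType).
Implicit Types f g : X -> R[i].

HB.instance Definition _ := [isSub for @C0_fun R X].
HB.instance Definition _ := [Choice of C0 R X by <:].

Lemma C0_continuous (f : C0 R X) : continuous f.
Proof. by have /asboolP[] := C0P f. Qed.

Lemma C0_vanishes (f : C0 R X) : vanishes_at_infinity f.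
Proof. by have /asboolP[] := C0P f. Qed.

Lemma closed_normc_ge f (e : R) : continuous f ->
  closed [set x | e <= normc (f x)].
Proof.
move=> cf; rewrite (_ : [set _ | _] = (@normc R \o f) @^-1` [set r | e <= r])//.
apply: preimage_closed; last exact: closed_ge.
by move=> x _; apply: continuous_comp; [exact: cf|exact: continuous_normc].
Qed.

Lemma continuous_vanishes_bounded f : continuous f -> vanishes_at_infinity f ->
  exists M : R, forall x, normc (f x) <= M.
Proof.
move=> cf vf.
have cK := vf 1 ltr01.
have : compact ((@normc R \o f) @` [set x | 1 <= normc (f x)]).
  apply: continuous_compact cK; apply: continuous_subspaceT => x.
  by apply: continuous_comp; [exact: cf|exact: continuous_normc].
move=> /compact_bounded[M [_ bM]].
exists (Num.max 1 (M + 1)) => x; rewrite le_max.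
case: (lerP (normc (f x)) 1) => //= /ltW fx.
have MM : M < M + 1 by rewrite ltrDl.
have nfx : ((@normc R \o f) @` [set x | 1 <= normc (f x)]) (normc (f x)).
  by exists x.
exact: le_trans (ler_norm _) (bM _ MM _ nfx).
Qed.

Lemma C0_bounded (f : C0 R X) : exists M : R, forall x, normc (f x) <= M.
Proof.
by apply: continuous_vanishes_bounded; [exact: C0_continuous|exact: C0_vanishes].
Qed.

Lemma C0_submod_closed : submod_closed (C0_pred R X).
Proof.
split.
  rewrite inE; split; first by move=> x; exact: cvg_cst.
  move=> e e0; rewrite (_ : [set _ | _] = set0); first exact: compact0.
  rewrite -subset0 => x /=; apply/negP; rewrite -ltNge.
  apply: le_lt_trans e0; rewrite le_eqVlt; apply/orP; left; apply/eqP.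
  exact: normc0.
move=> a f g; rewrite !inE => -[cf vf] [cg vg].
have cfg : continuous (a *: f + g).
  move=> x; apply: (@cvgD _ R[i] _ _ _ (a *: f) g); last exact: cg.
  by apply: cvgZr; exact: cf.
split=> // e e0.
pose k := normc a + 1.
have k0 : 0 < k by rewrite ltr_wpDl ?normc_ge0.
apply: (@subclosed_compact _ _ ([set x | e / 2 / k <= normc (f x)] `|`
                                [set x | e / 2 <= normc (g x)])).
- exact: closed_normc_ge.
- by apply: compactU; [apply: vf|apply: vg]; rewrite !divr_gt0.
move=> x /= efg; apply: contrapT => /not_orP[/negP + /negP].
rewrite -!ltNge => fx gx; move: efg; apply/negP; rewrite -ltNge.
apply: le_lt_trans (normcDle _ _) _; rewrite normcM [ltRHS]splitr.
rewrite ler_ltD//; move: fx; rewrite ltr_pdivlMr// => /ltW; apply: le_trans.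
by rewrite mulrC ler_wpM2l ?normc_ge0// lerDl.
Qed.

HB.instance Definition _ := GRing.isSubmodClosed.Build _ _ (C0_pred R X)
  C0_submod_closed.
HB.instance Definition _ := [SubChoice_isSubLmodule of C0 R X by <:].

Definition C0_norm (f : C0 R X) : R := sup [set normc (f x) | x in setT].

Lemma C0_norm_ub (f : C0 R X) x : normc (f x) <= C0_norm f.
Proof.
apply: ub_le_sup; last by exists x.
by have [M fM] := C0_bounded f; exists M => _ [y _ <-].
Qed.

Lemma C0_norm_le (f : C0 R X) (M : R) : 0 <= M ->
  (forall x, normc (f x) <= M) -> C0_norm f <= M.
Proof.
move=> M0 fM; rewrite /C0_norm; have [->|/set0P S0] :=
  eqVneq [set normc (f x) | x in setT] set0; first by rewrite sup0.
by apply: ge_sup => // _ [x _ <-].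
Qed.

Lemma C0_norm_ge0 (f : C0 R X) : 0 <= C0_norm f.
Proof.
rewrite /C0_norm; have [->|/set0P[_ [x _ _]]] :=
  eqVneq [set normc (f x) | x in setT] set0; first by rewrite sup0.
exact: le_trans (normc_ge0 _) (C0_norm_ub f x).
Qed.

Lemma C0_ler_normD (f g : C0 R X) :
  (C0_norm (f + g))%:C <= (C0_norm f)%:C + (C0_norm g)%:C.
Proof.
rewrite -rmorphD lecR; apply: C0_norm_le => [|x].
  by rewrite addr_ge0 ?C0_norm_ge0.
by apply: le_trans (normcDle _ _) _; rewrite lerD ?C0_norm_ub.
Qed.

Lemma C0_norm0_eq0 (f : C0 R X) : (C0_norm f)%:C = 0 -> f = 0.
Proof.
move=> [f0]; apply/val_inj/funext => x /=.
by apply: eq0_normc; apply/le_anti; rewrite normc_ge0 -[leRHS]f0 C0_norm_ub.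
Qed.

Lemma C0_normZ (a : R[i]) (f : C0 R X) :
  (C0_norm (a *: f))%:C = `|a| * (C0_norm f)%:C.
Proof.
have leZ (b : R[i]) (g : C0 R X) : C0_norm (b *: g) <= normc b * C0_norm g.
  apply: C0_norm_le => [|x]; first by rewrite mulr_ge0 ?normc_ge0 ?C0_norm_ge0.
  by rewrite normcM ler_wpM2l ?normc_ge0 ?C0_norm_ub.
rewrite -[`|a|]/((normc a)%:C) -rmorphM; congr (_%:C); apply/le_anti.
rewrite leZ /=; have [->|a0] := eqVneq a 0.
  by rewrite normc0 mul0r C0_norm_ge0.
have na0 : 0 < normc a.
  rewrite lt_neqAle normc_ge0 andbT eq_sym.
  by apply: contra a0 => /eqP/eq0_normc ->.
rewrite -ler_pdivlMl// -normcV -{1}[f](scale1r f) -(mulVf a0) -scalerA.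
exact: leZ.
Qed.

HB.instance Definition _ := Lmodule_isNormed.Build R[i] (C0 R X)
  C0_ler_normD C0_normZ C0_norm0_eq0.

Lemma C0_normE (f : C0 R X) :
  `|f| = (sup [set normc (f x) | x in setT])%:C.
Proof. by []. Qed.

Lemma C0_mul_subproof (f g : C0 R X) : (fun x => f x * g x) \in C0_pred R X.
Proof.
rewrite inE; have cfg : continuous (fun x => f x * g x).
  by move=> x; apply: cvgM; exact: C0_continuous.
split=> // e e0; have [M fM] := C0_bounded f.
pose k := Num.max M 1; have k0 : 0 < k by rewrite lt_max ltr01 orbT.
apply: subclosed_compact (closed_normc_ge cfg)
  (C0_vanishes (f := g) (divr_gt0 e0 k0)) _ => x /=.
rewrite normcM ler_pdivrMr// => /le_trans; apply.
by rewrite mulrC ler_wpM2l ?normc_ge0// le_max fM.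
Qed.

Definition C0_mul (f g : C0 R X) : C0 R X := MkC0 (C0_mul_subproof f g).

Lemma C0_star_subproof (f : C0 R X) : (fun x => (f x)^*) \in C0_pred R X.
Proof.
rewrite inE; split.
  move=> x; apply: (@continuous_comp _ _ _ f (@conjc R)).
    exact: C0_continuous.
  exact: continuous_conjc.
move=> e e0; under eq_set do rewrite normc_conj.
exact: C0_vanishes.
Qed.

Definition C0_star (f : C0 R X) : C0 R X := MkC0 (C0_star_subproof f).

Definition C0_inner (f g : C0 R X) : C0 R X := C0_mul (C0_star f) g.

End C0_lmodType.

(* A partially defined operator on A; the values of [op_fun] outside [op_dom]
   are meaningless, so that two operators are identified when they have the
   same graph. *)
Record operator (A : Type) := Operator {
  op_dom : set A;
  op_fun :> A -> A
}.

Definition graph (A : Type) (T : operator A) : set (A * A) :=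
  [set p | op_dom T p.1 /\ p.2 = T p.1].

Definition op_range (A : Type) (T : operator A) : set A := T @` op_dom T.

Definition op_id (A : Type) : operator A := Operator setT id.

Definition op_comp (A : Type) (S T : operator A) : operator A :=
  Operator [set x | op_dom T x /\ op_dom S (T x)] (fun x => S (T x)).

Definition op_add (A : zmodType) (S T : operator A) : operator A :=
  Operator (op_dom S `&` op_dom T) (fun x => S x + T x).

Section Operators.
Variables (K : numFieldType) (A : normedModType K).
Implicit Type T : operator A.

Definition linear_operator T : Prop :=
  op_dom T 0 /\
  forall (a : K) (x y : A), op_dom T x -> op_dom T y ->
    op_dom T (a *: x + y) /\ T (a *: x + y) = a *: T x + T y.

Definition closed_operator T : Prop := closed (graph T).

Definition closable T : Prop :=
  exists S : operator A, linear_operator S /\ graph S = closure (graph T).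

End Operators.

Section OperatorsOnC0.
Variables (R : realType) (X : topologicalType).
Implicit Type T : operator (C0 R X).

Definition is_adjoint_value T (y z : C0 R X) : Prop :=
  forall x, op_dom T x -> C0_inner (T x) y = C0_inner x z.

(* The value z of the adjoint at y is unique when the domain of T is dense;
   otherwise an arbitrary one is chosen. *)
Definition adjoint T : operator (C0 R X) :=
  Operator [set y | exists z, is_adjoint_value T y z]
           (fun y => xget 0 [set z | is_adjoint_value T y z]).

Definition semiregular T : Prop :=
  [/\ linear_operator T,
      (forall x a, op_dom T x -> op_dom T (C0_mul x a)),
      dense (op_dom T),
      closable T &
      dense (op_dom (adjoint T))].

Definition regular T : Prop :=
  [/\ semiregular T,
      closed_operator T &
      dense (op_range (op_add (op_id _) (op_comp (adjoint T) T)))].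

End OperatorsOnC0.

(* Main.v *)
Require Import Defs.
From mathcomp Require Import all_boot all_order all_algebra.
From mathcomp Require Import complex ring lra.
From mathcomp Require Import all_classical all_reals all_analysis.

(** A densely defined operator [T] on [C0 R X] with densely defined adjoint is
    multiplication by a function. If [z] is the value of the adjoint at [y],
    then [conj (T f) y = conj f z] for all [f] in the domain, so that
    [T f = h f] with [h = conj (z / y)] wherever [y] does not vanish
    ([operator_symbol]). Density of the domain of the adjoint provides such a
    [y] near every point where some function of [C0 R X] does not vanish, which
    defines [h] and makes it continuous there; the remaining points are
    irrelevant, because every function vanishes at them.

    The adjoint of [T] multiplies by [conj h], so [I + T^* T] multiplies by
    [1 + |h|^2], and the equation [(I + T^* T) f = g a], where [g] is in the
    domain and [a] is arbitrary, is solved by [f = g (a / (1 + |h|^2))]. The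
    quotient [a / (1 + |h|^2)] is continuous and vanishes at infinity
    ([C0_div]), hence [f] is in the domain, which is a right ideal, and [T f]
    is in the domain of the adjoint. The range of [I + T^* T] therefore
    contains all products [g a], and these are dense ([dense_C0_mul]). *)

Set Implicit Arguments.
Unset Strict Implicit.
Unset Printing Implicit Defensive.

Import Order.TTheory GRing.Theory Num.Theory numFieldNormedType.Exports.
Import Normc.

Local Open Scope classical_set_scope.
Local Open Scope ring_scope.
Local Open Scope complex_scope.

Local Notation "x ^*" := (conjc x) : ring_scope.

(** * Complex numbers of the form w / (1 + |z|^2) *)

Section Scalars.
Variable R : realType.
Implicit Type z : R[i].

Lemma onep_conjcM z : 1 + z^* * z = (1 + normc z ^+ 2)%:C.
Proof.
by rewrite mulrC -normCK -[`|z|]/((normc z)%:C) rmorphD rmorphXn rmorph1.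
Qed.

Lemma onep_conjcM_neq0 z : 1 + z^* * z != 0.
Proof.
rewrite onep_conjcM; apply/eqP => -[/eqP].
by rewrite paddr_eq0 ?ler01 ?sqr_ge0// oner_eq0.
Qed.

Lemma normcV_onep_conjcM z :
  normc (1 + z^* * z)^-1 = (1 + normc z ^+ 2)^-1.
Proof.
by rewrite onep_conjcM normcV normc_real ger0_norm// addr_ge0// sqr_ge0.
Qed.

Lemma normc_div_onep_conjcM_le w z : normc (w / (1 + z^* * z)) <= normc w.
Proof.
rewrite normcM normcV_onep_conjcM ler_piMr ?normc_ge0//.
by rewrite invf_le1 ?lerDl ?sqr_ge0// ltr_pwDl// sqr_ge0.
Qed.

Lemma normc_div_onep_conjcM_le1 z : normc (z / (1 + z^* * z)) <= 1.
Proof.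
have z0 := normc_ge0 z.
rewrite normcM normcV_onep_conjcM ler_pdivrMr ?mul1r; first by nra.
by rewrite ltr_pwDl// sqr_ge0.
Qed.

End Scalars.

(** * Density and quotients in the algebra of functions *)

Section C0Functions.
Variables (R : realType) (X : topologicalType).
Implicit Types (a f g : C0 R X) (S : set (C0 R X)).

(** Density amounts to uniform approximation, with real tolerances (the norm of
    [C0 R X] takes values in [R[i]]). *)
Lemma dense_C0P S : dense S <->
  forall f (e : R), 0 < e ->
    exists2 g, S g & forall x, normc (f x - g x) <= e.
Proof.
split=> [dS f e e0|apS O [f Of] oO].
  have e0' : 0 < e%:C by rewrite ltcR.
  have [||g [+ Sg]] := dS (ball f e%:C) _ _.
  - by exists f; exact: ballxx.
  - exact: ball_open.
  rewrite -ball_normE /= -[`|_|]/((C0_norm (f - g))%:C) ltcR => fg.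
  by exists g => // x; exact: le_trans (C0_norm_ub (f - g) x) (ltW fg).
have /nbhs_ballP[[e e'] /= + fO] : nbhs f O by exact: open_nbhs_nbhs.
rewrite ltcE /= => /andP[/eqP e'0 e0].
have e20 : 0 < e / 2 by rewrite divr_gt0.
have [g Sg fg] := apS f _ e20.
exists g; split=> //; apply: fO; rewrite -ball_normE /= e'0.
rewrite -[`|_|]/((C0_norm (f - g))%:C) ltcR.
apply: (@le_lt_trans _ _ (e / 2)); last lra.
by apply: C0_norm_le => //; exact: ltW.
Qed.

(** Points where some function does not vanish are detected by dense sets. *)
Lemma dense_C0_neq0 S f x : dense S -> f x != 0 ->
  exists2 g, S g & g x != 0.
Proof.
move=> /dense_C0P dS fx0.
have fx : 0 < normc (f x).
  rewrite lt_neqAle normc_ge0 andbT eq_sym.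
  by apply: contra fx0 => /eqP/eq0_normc ->.
have e0 : 0 < normc (f x) / 2 by rewrite divr_gt0.
have [g Sg fg] := dS f _ e0; exists g => //.
by apply/eqP => gx; have := fg x; rewrite gx subr0; lra.
Qed.

(** Where [a] vanishes, no continuity of [h] is needed because the quotient is
    dominated by [a]. *)
Lemma C0_div_subproof a (h : X -> R[i]) :
  (forall x, a x != 0 -> {for x, continuous h}) ->
  (fun x => a x / (1 + (h x)^* * h x)) \in C0_pred R X.
Proof.
move=> ch; have cq : continuous (fun x => a x / (1 + (h x)^* * h x)).
  move=> x; have [ax0|ax0] := eqVneq (a x) 0.
    apply/cvg_normcP => e e0; have /cvg_normcP := C0_continuous (f := a) (x := x).
    move=> /(_ e e0); apply: filterS => y.
    rewrite ax0 mul0r !sub0r !normcN; apply: le_lt_trans.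
    exact: normc_div_onep_conjcM_le.
  apply: cvgM; first exact: C0_continuous.
  apply: cvgV; first exact: onep_conjcM_neq0.
  apply: cvgD; first exact: cvg_cst.
  apply: cvgM; last exact: ch.
  apply: (@continuous_comp _ _ _ h (@conjc R)); first exact: ch.
  exact: continuous_conjc.
rewrite inE; split=> // e e0.
apply: subclosed_compact (closed_normc_ge (e := e) cq)
  (C0_vanishes (f := a) e0) _ => x /= /le_trans; apply.
exact: normc_div_onep_conjcM_le.
Qed.

(** The function [a / (1 + |h|^2)], as an element of [C0 R X], for [h]
    continuous where [a] does not vanish. *)
Definition C0_div a h ch : C0 R X := MkC0 (@C0_div_subproof a h ch).

(** Products [g a] with [g] in a dense set are dense: [g] is approximated by
    [g a] with [a = |n g|^2 / (1 + |n g|^2)], where [n] is large. *)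
Lemma dense_C0_mul S : dense S ->
  dense [set C0_mul g a | g in S & a in setT].
Proof.
move=> /dense_C0P dS; apply/dense_C0P => f e e0.
have e20 : 0 < e / 2 by rewrite divr_gt0.
have [g Sg fg] := dS f _ e20.
pose n := (e / 2)^-1%:C; pose u := n *: g.
have n0 : n != 0.
  by apply/eqP => -[/eqP]; rewrite invr_eq0 gt_eqF.
have cu x : C0_inner u u x != 0 -> {for x, continuous u}.
  by move=> _; exact: C0_continuous.
exists (C0_mul g (C0_div cu)); first by exists g => //; exists (C0_div cu).
move=> x; rewrite [e]splitr -(subrKA (g x)).
apply: le_trans (normcDle _ _) _; apply: lerD => //.
(* The error is [n^-1 u / (1 + |u|^2)], and [|u| <= 1 + |u|^2]. *)
have -> : g x - C0_mul g (C0_div cu) x =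
          n^-1 * (u x / (1 + (u x)^* * u x)).
  rewrite -[C0_mul _ _ x]/(g x * ((u x)^* * u x / (1 + (u x)^* * u x))).
  have -> : g x = n^-1 * u x by rewrite -[u x]/(n * g x) mulKf.
  have E (k v c : R[i]) : k != 0 -> 1 + c * v != 0 ->
      k^-1 * v - k^-1 * v * (c * v / (1 + c * v)) =
      k^-1 * (v / (1 + c * v)).
    by move=> k0 c0; field; rewrite c0 k0.
  exact: E n0 (onep_conjcM_neq0 _).
rewrite normcM normcV normc_real ger0_norm ?invr_ge0 ?(ltW e20)// invrK.
by rewrite ler_piMr ?normc_div_onep_conjcM_le1// ltW.
Qed.

End C0Functions.

(** * Operators as multiplications *)

Section Operators.
Variables (R : realType) (X : topologicalType) (T : operator (C0 R X)).

Lemma is_adjoint_value_unique y z z' : dense (op_dom T) ->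
  is_adjoint_value T y z -> is_adjoint_value T y z' -> z = z'.
Proof.
move=> dT yz yz'; apply/val_inj/funext => x; apply/eqP; rewrite -subr_eq0.
apply/negPn/negP => zx.
have [f Df fx] := dense_C0_neq0 (f := z - z') dT zx.
have : C0_inner f z x = C0_inner f z' x by rewrite -yz// -yz'.
have fx' : (f x)^* != 0 by rewrite conjc_eq0.
by move=> /(mulfI fx') /eqP; rewrite -subr_eq0; exact/negP.
Qed.

Lemma adjointE y z : dense (op_dom T) ->
  is_adjoint_value T y z -> adjoint T y = z.
Proof.
move=> dT yz; rewrite /adjoint /=; case: xgetP => [z' _ yz'|/(_ z)//].
exact: is_adjoint_value_unique dT yz' yz.
Qed.

(** [T] acts as multiplication by a function. If [z] is the value of the
    adjoint at [y], then [conj (T f) y = conj f z], so the function is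
    [conj (z / y)] where [y] does not vanish. *)
Lemma operator_symbol : dense (op_dom T) -> dense (op_dom (adjoint T)) ->
  exists h : X -> R[i],
  (forall a x, (a : C0 R X) x != 0 -> {for x, continuous h}) /\
  (forall f x, op_dom T f -> T f x = h x * f x).
Proof.
move=> dT dT'.
(* At a point where every [y] vanishes, [h] gets the default value [0]. *)
pose P x := [set p : C0 R X * C0 R X | is_adjoint_value T p.1 p.2 /\ p.1 x != 0].
pose h x := let p := xget (0, 0) (P x) in (p.2 x / p.1 x)^*.
have TE y z f x : is_adjoint_value T y z -> y x != 0 -> op_dom T f ->
    T f x = (z x / y x)^* * f x.
  move=> yz yx Df; apply: (can_inj (@conjcK R)); rewrite rmorphM /= conjcK.
  apply: (mulIf yx); rewrite mulrAC divfK// [RHS]mulrC.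
  by have := congr1 (fun g : C0 R X => g x) (yz f Df).
have hE y z x : is_adjoint_value T y z -> y x != 0 -> h x = (z x / y x)^*.
  move=> yz yx; have [f Df fx] := dense_C0_neq0 dT yx.
  apply: (mulIf fx); rewrite -(TE y z)// /h; case: xgetP => [p _ [p1 p2]|/(_ (y, z))].
    by rewrite -TE.
  by case; split.
exists h; split=> [a x ax|f x Df]; last first.
  have [fx0|/(dense_C0_neq0 dT')[y [z yz] yx]] := eqVneq (f x) 0.
    have [Tfx0|/(dense_C0_neq0 dT')[y [z yz] yx]] := eqVneq (T f x) 0.
      by rewrite fx0 Tfx0 mulr0.
    by rewrite (hE y z)// -TE.
  by rewrite (hE y z)// -TE.
have [y [z yz] yx] := dense_C0_neq0 dT' ax.
have yn : \forall t \near x, y t != 0.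
  by apply: cvgr_neq0 yx; exact: C0_continuous.
have cq : {for x, continuous (fun t => (z t / y t)^*)}.
  apply: (@continuous_comp _ _ _ (fun t => z t / y t) (@conjc R)).
    apply: cvgM; first exact: C0_continuous.
    by apply: cvgV => //; exact: C0_continuous.
  exact: continuous_conjc.
rewrite /prop_for /continuous_at (hE y z x)//; apply: cvg_trans cq.
by apply: near_eq_cvg; apply: filterS yn => t yt; rewrite (hE y z).
Qed.

End Operators.

Theorem proposition4p1 (R : realType) (X : topologicalType)
  (lcX : locally_compact [set: X]) (hX : hausdorff_space X)
  (T : operator (C0 R X)) :
  semiregular T -> closed_operator T -> regular T.
Proof.
move=> sT cT; split=> //; have [lT mT dT _ dT'] := sT.
have [h [ch hT]] := operator_symbol dT dT'.
move=> O O0 oO; have [_ [/[swap] -[g Dg [a _ <-]] Og]] := dense_C0_mul dT O0 oO.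
exists (C0_mul g a); split=> //.
pose b := C0_div (ch a); pose f := C0_mul g b.
have Df : op_dom T f by exact: mT.
have Tf : is_adjoint_value T (T f) (C0_mul g (a - b)).
  (* Both sides are [conj k |h|^2 f]. *)
  move=> k Dk; apply/val_inj/funext => x.
  rewrite -[LHS]/((T k x)^* * T f x) !hT// rmorphM /=.
  rewrite -[RHS]/((k x)^* * (g x * (a x - a x / (1 + (h x)^* * h x)))).
  move: (onep_conjcM_neq0 (h x)); move: (h x) (h x)^* (k x)^* => v c l c0.
  by field.
exists f; first by split=> //; split=> //; exists (C0_mul g (a - b)).
rewrite -[LHS]/(f + adjoint T (T f)) (adjointE dT Tf).
apply/val_inj/funext => x.
by rewrite -[LHS]/(g x * b x + g x * (a x - b x)) -mulrDr addrC subrK.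
Qed.
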